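(* Let $\mathcal{X}$ be a real Banach space and let $\mathcal{F}\subset\mathcal{X}$ be a compact set contained in the closed unit ball of $\mathcal{X}$ whose linear span is infinite dimensional. Let $\{f_n\}_{n\ge0}$, $\{g_n\}_{n\ge0}$, $\{V_n\}_{n\ge0}$ be any realization of the Natural Greedy Algorithm for $\mathcal{F}$, and let $\sigma_n(\mathcal{F},\mathcal{X})=\sup_{f\in\mathcal{F}}\operatorname{dist}(f,V_n)$. Then for every integer $n\ge2$ $$\sigma_n(\mathcal{F},\mathcal{X})\le\sqrt2\,B^g_{n/2}(\mathcal{F},\mathcal{X})\min_{0<m<n}\gamma_{n+m}(\mathcal{X})\,d_m(\mathcal{F},\mathcal{X})^{1-m/n},$$ where the minimum is over integers $m$.
   Context: Norming functionals: for $x\in\mathcal{X}\setminus\{0\}$, a norming functional $F_x\in\mathcal{X}^*$ satisfies $\|F_x\|_{\mathcal{X}^*}=1$ and $F_x(x)=\|x\|$ (if it is not unique, any choice is allowed, fixed once for each $g_n$). Natural Greedy Algorithm (NGA): Set $\mathcal{R}_0(f)=f$ and $V_0=\{0\}$. For $n=0,1,2,\dots$: choose $f_n\in\mathcal{F}$ with $\|\mathcal{R}_n(f_n)\|=\max_{f\in\mathcal{F}}\|\mathcal{R}_n(f)\|$; put $g_n=\mathcal{R}_n(f_n)/\|\mathcal{R}_n(f_n)\|$; choose a norming functional $F_{g_n}$; put $r_n(f)=f-F_{g_n}(f)\,g_n$, $\mathcal{R}_{n+1}=r_n\circ\mathcal{R}_n=r_n\circ r_{n-1}\circ\dots\circ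 r_0$, and $V_{n+1}=\operatorname{span}\{f_0,\dots,f_n\}=\operatorname{span}\{g_0,\dots,g_n\}$. Any sequences produced by such choices form a realization. $\operatorname{dist}(f,V)=\inf_{v\in V}\|f-v\|$. Kolmogorov width: $d_n(\mathcal{F},\mathcal{X})=\inf_{X_n}\sup_{f\in\mathcal{F}}\operatorname{dist}(f,X_n)$, the infimum over $n$-dimensional subspaces $X_n\subset\mathcal{X}$. $\gamma_n(\mathcal{X})=\sup\{d(V,\ell_2^n): V\subset\mathcal{X},\ \dim V=n\}$, where $d(V,W)=\inf\{\|T\|\,\|T^{-1}\|: T:V\to W \text{ linear isomorphism}\}$ is the multiplicative Banach–Mazur distance. Modulus of smoothness: $\rho(u)=\sup_{\|x\|=\|y\|=1}\frac{\|x+uy\|+\|x-uy\|}{2}-1$. $R(\mathcal{X})=1+\mu$, where $\mu\in(0,1]$ is such that $1+\mu=2\mu\,\rho(\mu^{-1})$. $C_g=C_g(\mathcal{F},\mathcal{X})\in[1,\infty]$ is the basis constant of $\{g_n\}_{n\ge0}$: the supremum over $n\ge1$ of the operator norms of the partial sum projections $\sum_k\alpha_kg_k\mapsto\sum_{k<n}\alpha_kg_k$ on the linear span of $\{g_k\}_{k\ge0}$. $B^g_s(\mathcal{F},\mathcal{X})=\min\{R(\mathcal{X})^s,\ C_g(\mathcal{F},\mathcal{X})+1\}$ for real $s\ge0$. *)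

(* Defs.v *)
From mathcomp Require Import all_boot all_order all_algebra.
From mathcomp Require Import all_classical all_reals all_analysis.
Import Order.TTheory GRing.Theory Num.Theory.
Import numFieldNormedType.Exports.

Set Implicit Arguments.
Unset Strict Implicit.
Unset Printing Implicit Defensive.

Local Open Scope classical_set_scope.
Local Open Scope ring_scope.

Section LinearAlgebra.
Context {R : realType}.

Definition lin_span (E : lmodType R) (A : set E) : set E :=
  [set x | exists (n : nat) (a : 'I_n -> R) (v : 'I_n -> E),
     (forall i, A (v i)) /\ x = \sum_(i < n) a i *: v i].

Definition lin_indep (E : lmodType R) (n : nat) (v : 'I_n -> E) : Prop :=
  forall a : 'I_n -> R, \sum_(i < n) a i *: v i = 0 -> forall i, a i = 0.

(** [V] is a linear subspace of dimension exactly [n]. *)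
Definition has_dim (E : lmodType R) (n : nat) (V : set E) : Prop :=
  exists v : 'I_n -> E, lin_indep v /\ V = lin_span (range v).

Definition infinite_dim (E : lmodType R) (V : set E) : Prop :=
  ~ exists n, has_dim n V.

(** [T] restricts to a linear isomorphism from the subspace [V] onto the
    subspace [W], with inverse [S]; the values outside [V] and [W] are
    irrelevant. *)
Definition linear_iso (E1 E2 : lmodType R) (V : set E1) (W : set E2)
    (T : E1 -> E2) (S : E2 -> E1) : Prop :=
  [/\ forall (a : R) x y, V x -> V y -> T (a *: x + y) = a *: T x + T y,
      forall x, V x -> W (T x),
      forall y, W y -> V (S y),
      forall x, V x -> S (T x) = x
    & forall y, W y -> T (S y) = y].

(** Operator norm of [T] on the subspace [V].  The norms are explicit arguments
    because the library norm on ['rV[R]_n] is the sup norm, whereas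
    [l_2^n] needs the Euclidean one. *)
Definition opnorm (E1 E2 : lmodType R) (N1 : E1 -> R) (N2 : E2 -> R)
    (V : set E1) (T : E1 -> E2) : \bar R :=
  ereal_sup [set (N2 (T x))%:E | x in [set x | V x /\ N1 x <= 1]].

Definition banach_mazur (E1 E2 : lmodType R) (N1 : E1 -> R) (N2 : E2 -> R)
    (V : set E1) (W : set E2) : \bar R :=
  ereal_inf [set d | exists (T : E1 -> E2) (S : E2 -> E1),
    linear_iso V W T S /\ d = (opnorm N1 N2 V T * opnorm N2 N1 W S)%E].

Definition l2norm (n : nat) (v : 'rV[R]_n) : R :=
  Num.sqrt (\sum_(i < n) v 0 i ^+ 2).

End LinearAlgebra.

Section BanachSpace.
Context {R : realType} (X : normedModType R).

Definition banach_mazur_l2 (n : nat) (V : set X) : \bar R :=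
  banach_mazur (fun x : X => `|x|) (@l2norm R n) V [set: 'rV[R]_n].

Definition gamma_ (n : nat) : \bar R :=
  ereal_sup [set banach_mazur_l2 n V | V in [set V : set X | has_dim n V]].

Definition dist (x : X) (V : set X) : \bar R :=
  ereal_inf [set `|x - v|%:E | v in V].

(** [sup_(x in F) dist (x, V)]. *)
Definition deviation (F V : set X) : \bar R :=
  ereal_sup [set dist x V | x in F].

Definition kolmogorov_width (n : nat) (F : set X) : \bar R :=
  ereal_inf [set deviation F V | V in [set V : set X | has_dim n V]].

(** The set is bounded above by [1 + `|u|], and nonempty as soon as [X] is
    nonzero. *)
Definition smoothness (u : R) : R :=
  sup [set r | exists x y : X, [/\ `|x| = 1, `|y| = 1
         & r = (`|x + u *: y| + `|x - u *: y|) / 2]] - 1.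

(** For nonzero [X] there is exactly one such [mu].  With [u := mu^-1] the
    equation reads [smoothness u = (u + 1) / 2]; [smoothness] is convex and
    1-Lipschitz, with [smoothness 0 = 0], [smoothness 1 <= 1] and
    [smoothness 3 >= 2].  The default value of [xget] is thus never used. *)
Definition smoothness_mu : R :=
  xget 0 [set mu | 0 < mu <= 1 /\ 1 + mu = 2 * mu * smoothness mu^-1].

Definition R_const : R := 1 + smoothness_mu.

Definition dual_norm (phi : {linear X -> R^o}) : \bar R :=
  opnorm (fun x : X => `|x|) (fun r : R^o => `|r|) [set: X] phi.

Definition norming_functional (x : X) (phi : {linear X -> R^o}) : Prop :=
  [/\ x != 0, dual_norm phi = 1%E & phi x = `|x|].

Fixpoint nga_residual (g : nat -> X) (phi : nat -> {linear X -> R^o})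
    (n : nat) (x : X) : X :=
  if n is m.+1 then
    let y := nga_residual g phi m x in y - (phi m y : R) *: g m
  else x.

Definition nga_realization (F : set X) (f g : nat -> X)
    (phi : nat -> {linear X -> R^o}) : Prop :=
  forall n, let Rn := nga_residual g phi n in
    [/\ F (f n),
        forall h, F h -> `|Rn h| <= `|Rn (f n)|,
        g n = `|Rn (f n)|^-1 *: Rn (f n)
      & norming_functional (g n) (phi n)].

Definition nga_space (f : nat -> X) (n : nat) : set X :=
  lin_span [set f k | k in `I_n].

Definition nga_sigma (F : set X) (f : nat -> X) (n : nat) : \bar R :=
  deviation F (nga_space f n).

(** Operator norm of the partial sum projection
    [\sum_(k < N) a k *: g k |-> \sum_(k < N | k < n) a k *: g k] on the span
    of all the [g k] ([N] arbitrary).  It is well defined since the [g k]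
    of a realization are linearly independent. *)
Definition partial_sum_norm (g : nat -> X) (n : nat) : \bar R :=
  ereal_sup [set c | exists (N : nat) (a : nat -> R),
    `|\sum_(k < N) a k *: g k| <= 1 /\
    c = `|\sum_(k < N | (k < n)%N) a k *: g k|%:E].

Definition basis_constant (g : nat -> X) : \bar R :=
  ereal_sup [set partial_sum_norm g n | n in [set n | (1 <= n)%N]].

Definition B_const (g : nat -> X) (s : R) : \bar R :=
  Order.min (R_const `^ s)%:E (basis_constant g + 1)%E.

End BanachSpace.

(* Main.v *)
Require Import Defs.
From mathcomp Require Import all_boot all_order all_algebra all_fingroup.
From mathcomp Require Import all_classical all_reals all_analysis.
From mathcomp Require Import zify ring lra.
Import Order.TTheory GRing.Theory Num.Theory.
Import numFieldNormedType.Exports.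

Set Implicit Arguments.
Unset Strict Implicit.
Unset Printing Implicit Defensive.

Local Open Scope classical_set_scope.
Local Open Scope ring_scope.

(** Let [tau k] be the norm of the residual [Res k (f k)], so that [sigma_n <=
    tau k] for [k <= n].  Since [Res k] kills [f 0], ..., [f (k - 1)], every
    vector [y = f k + (combination of the f j, j < k)] satisfies
    [tau k <= b_k |y|], where [b_k] bounds the norm of [Res k]: both [R^k] and
    [C_g + 1] will do.  Given an [m]-dimensional [V] nearly optimal for the
    Kolmogorov width, put on an [n + m]-dimensional space containing [V] and
    [f 0], ..., [f (n - 1)] a Euclidean norm equivalent to the given one up to
    a factor [c] close to [gamma_(n + m)].  The squared Euclidean volume
    spanned by [f 0], ..., [f (n - 1)] is the product of the squared norms of
    the Gram-Schmidt vectors, hence at least the product of the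
    [(tau k / b_k)^2].  On the other hand the [f k] are within [c d_m] of [V],
    so a rotation makes [n - m] rows of the coordinate matrix small on average;
    Hadamard's inequality and the AM-GM inequality then bound the squared
    volume by [2^n c^(2n) d_m^(2(n - m))]. *)

(** * Gram matrices: Gram-Schmidt, Hadamard's inequality and a determinant bound *)

Section Gram.
Context {R : rcfType}.

Definition unitriangular (n : nat) (L : 'M[R]_n) : Prop :=
  is_trig_mx L /\ forall i, L i i = 1.

Lemma det_unitriangular n (L : 'M[R]_n) : unitriangular L -> \det L = 1.
Proof. by case=> Lt L1; rewrite det_trig // big1. Qed.

Lemma gram_diagE n N (A : 'M[R]_(n, N)) i :
  (A *m A^T) i i = \sum_j A i j ^+ 2.
Proof. by rewrite mxE; apply: eq_bigr => j _; rewrite mxE expr2. Qed.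

Lemma gram_diag_ge0 n N (A : 'M[R]_(n, N)) i : 0 <= (A *m A^T) i i.
Proof. by rewrite gram_diagE; apply: sumr_ge0 => j _; rewrite sqr_ge0. Qed.

Lemma gram_row_eq0 N (a : 'rV[R]_N) : (a *m a^T) 0 0 = 0 -> a = 0.
Proof.
rewrite gram_diagE => /eqP; rewrite psumr_eq0; last by move=> j _; rewrite sqr_ge0.
move=> /allP h; apply/rowP => j; rewrite mxE.
by have /h := mem_index_enum j; rewrite /= sqrf_eq0 => /eqP.
Qed.

(** Induction on the rows: make the rows below the first one orthogonal to it, then recurse on them.
    The inverse [M] is returned too, since it recovers [A] from the orthogonal rows. *)
Lemma gram_schmidt n N (A : 'M[R]_(n, N)) : exists L M : 'M[R]_n,
  [/\ L *m M = 1%:M, unitriangular L, unitriangular M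
    & is_diag_mx ((L *m A) *m (L *m A)^T)].
Proof.
elim: n A => [|n IH] A.
  exists 1%:M, 1%:M; split; rewrite ?mulmx1 //;
    try by split=> [|[]//]; apply/is_trig_mxP; case.
  by apply/is_diag_mxP; case.
change ('M[R]_(1 + n, N)) in (type of A).
pose a := usubmx A; pose A' := dsubmx A.
(* If [a] is zero, the inverse is the default [0^-1 = 0], and the rows below are already orthogonal
   to [a]. *)
pose c := ((a *m a^T) 0 0)^-1 *: (A' *m a^T).
pose A'' := A' - c *m a.
have A''a : A'' *m a^T = 0.
  rewrite mulmxBl -mulmxA; have [a0|an0] := eqVneq ((a *m a^T) 0 0) 0.
    by rewrite (gram_row_eq0 a0) trmx0 !mulmx0 subrr.
  rewrite [X in c *m X]mx11_scalar mul_mx_scalar scalerA divff //.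
  by rewrite scale1r subrr.
have [L [M [LM Lu Mu D]]] := IH A''.
pose L1 : 'M[R]_(1 + n) := block_mx 1%:M 0 (- (L *m c)) L.
pose M1 : 'M[R]_(1 + n) := block_mx 1%:M 0 c M.
have blocku (u : 'cV[R]_n) (K : 'M[R]_n) : unitriangular K ->
    unitriangular (block_mx 1%:M 0 u K : 'M[R]_(1 + n)).
  case=> Kt K1; split.
    rewrite is_trig_block_mx // eqxx Kt !andbT.
    by apply/is_trig_mxP=> i j; rewrite !ord1.
  by move=> i; case: (split_ordP i) => k ->; rewrite ?block_mxEul ?block_mxEdr // mxE eqxx.
have LM1 : L1 *m M1 = 1%:M.
  rewrite mulmx_block !mulmx0 !mul0mx !mulmx1 LM !addr0 !add0r.
  by rewrite addNr [RHS]scalar_mx_block.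
have Ecol : L1 *m A = col_mx a (L *m A'').
  rewrite -[A in LHS]vsubmxK mul_block_col mul1mx mul0mx addr0; congr col_mx.
  by rewrite mulmxBr addrC mulNmx mulmxA.
have z : a *m (L *m A'')^T = 0.
  by apply: trmx_inj; rewrite trmx_mul trmxK trmx0 -mulmxA A''a mulmx0.
have D1 : is_diag_mx ((L1 *m A) *m (L1 *m A)^T).
  rewrite Ecol tr_col_mx mul_col_row is_diag_block_mx // z -mulmxA A''a mulmx0.
  rewrite !eqxx D andbT; apply/is_diag_mxP=> i j; by rewrite !ord1.
by exists L1, M1; split; [exact: LM1 | exact: blocku | exact: blocku | exact: D1].
Qed.

Lemma det_gram_unitriangular n N (A : 'M[R]_(n, N)) (L : 'M[R]_n) :
    unitriangular L -> is_diag_mx ((L *m A) *m (L *m A)^T) ->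
  \det (A *m A^T) = \prod_i ((L *m A) *m (L *m A)^T) i i.
Proof.
move=> Lu D; rewrite -det_trig; last exact: is_diag_mx_is_trig.
rewrite trmx_mul mulmxA -(mulmxA L) !det_mulmx det_tr (det_unitriangular Lu).
by rewrite mul1r mulr1.
Qed.

(** Write [A = M B] with [B] having orthogonal rows. By Pythagoras the squared norm of row [i] of
    [A] is at least its part along row [i] of [B], where the coefficient [M i i] is 1. *)
Lemma hadamard_gram n N (A : 'M[R]_(n, N)) :
  \det (A *m A^T) <= \prod_i (A *m A^T) i i.
Proof.
have [L [M [LM Lu [_ M1] D]]] := gram_schmidt A.
rewrite (det_gram_unitriangular Lu D); apply: ler_prod => i _.
rewrite gram_diag_ge0 /=.
set B := L *m A in D *; have -> : A = M *m B by rewrite mulmxA (mulmx1C LM) mul1mx.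
have -> : M *m B *m (M *m B)^T = M *m (B *m B^T) *m M^T.
  by rewrite trmx_mul !mulmxA.
set E := B *m B^T in D *.
have -> : (M *m E *m M^T) i i = \sum_j M i j ^+ 2 * E j j.
  rewrite mxE; apply: eq_bigr => j _; rewrite [M^T _ _]mxE mxE (bigD1 j) //= big1.
    by rewrite addr0; ring.
  by move=> k kj; rewrite (is_diag_mxP D) ?mulr0.
rewrite (bigD1 i) //= M1 expr1n mul1r lerDl.
by apply: sumr_ge0 => j _; rewrite mulr_ge0 ?sqr_ge0 ?gram_diag_ge0.
Qed.

(** The left kernel of [W] has dimension at least [n - m]; vectors spanning that much of it are
    completed to a basis, which is then orthonormalised. *)
Lemma orthogonal_left_kernel n N m (W : 'M[R]_(n, N)) : (\rank W <= m)%N ->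
  exists2 U : 'M[R]_n, U *m U^T = 1%:M &
    forall i : 'I_n, (i < n - m)%N -> row i U *m W = 0.
Proof.
move=> rW; pose K0 := invmx (col_ebase W).
have K0W (i : 'I_n) : (m <= i)%N -> row i K0 *m W = 0.
  move=> mi; rewrite -row_mul -[W in K0 *m W]mulmx_ebase -mulmxA mulKmx ?col_ebase_unit //.
  rewrite row_mul; apply/eqP; rewrite (_ : row i _ = 0) ?mul0mx //.
  by apply/rowP => j; rewrite !mxE ltnNge (leq_trans rW mi) andbF.
(* Gram-Schmidt preserves the spans of initial segments of rows, so the rows that annihilate [W],
   last in [K0], are moved to the front. *)
pose K := row_perm (perm (@rev_ord_inj n)) K0.
have KW (i : 'I_n) : (i < n - m)%N -> row i K *m W = 0.
  move=> im; have -> : row i K = row (rev_ord i) K0.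
    by apply/rowP => j; rewrite !mxE permE.
  by apply: K0W => /=; have := ltn_ord i; lia.
have Ku : K \in unitmx.
  rewrite /K row_permE unitmx_mul unitmx_perm /=.
  by rewrite unitmx_inv col_ebase_unit.
have [L [M [LM Lu _ D]]] := gram_schmidt K.
set B := L *m K in D *.
have Bu : B \in unitmx.
  by rewrite unitmx_mul Ku andbT unitmxE (det_unitriangular Lu) unitr1.
have BW (i : 'I_n) : (i < n - m)%N -> row i B *m W = 0.
  move=> im; rewrite row_mul -mulmxA mulmx_sum_row big1 // => j _.
  have [ij|ji] := ltnP i j.
    by rewrite !mxE (is_trig_mxP (proj1 Lu)) ?scale0r.
  by rewrite row_mul KW ?scaler0 //; apply: leq_ltn_trans ji im.
pose d i := (B *m B^T) i i.
have d_gt0 i : 0 < d i.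
  rewrite lt_def gram_diag_ge0 andbT; apply/eqP => di0.
  suff /eqP/(congr1 (fun X => X *m invmx B)) : row i B == 0.
    rewrite mul0mx -row_mul mulmxV // => /rowP/(_ i); rewrite !mxE eqxx => /eqP.
    by rewrite oner_eq0.
  apply/eqP/gram_row_eq0; rewrite -{}di0 /d !mxE.
  by apply: eq_bigr => j _; rewrite !mxE.
pose s := \row_i (Num.sqrt (d i))^-1.
exists (diag_mx s *m B); last first.
  by move=> i im; rewrite row_mul row_diag_mx -scalemxAl -rowE -scalemxAl BW // scaler0.
rewrite trmx_mul tr_diag_mx mulmxA -(mulmxA (diag_mx s)).
rewrite mul_mx_diag mul_diag_mx; apply/matrixP => i j.
have sE k : s 0 k = (Num.sqrt (d k))^-1 by rewrite mxE.
rewrite [LHS]mxE [X in X * _]mxE !sE [RHS]mxE.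
have [<-|ij] := eqVneq i j; last by rewrite (is_diag_mxP D) ?mulr0 ?mul0r.
have : Num.sqrt (d i) != 0 by rewrite gt_eqF // sqrtr_gt0.
have -> : (B *m B^T) i i = Num.sqrt (d i) ^+ 2 by rewrite sqr_sqrtr // ltW.
by move: (Num.sqrt (d i)) => x x0; rewrite mulr1n; field.
Qed.

(** Multiplication by the rotation [U] changes neither the Gram determinant nor the sum of the
    squared row norms, and the first [n - m] rows of [U A] coincide with those of [U (A - W)]. *)
Lemma det_gram_le n N m (A W : 'M[R]_(n, N)) (p q : R) :
    (\rank W <= m <= n)%N -> 0 < p -> 0 < q ->
    (forall i, (A *m A^T) i i <= p) ->
    (forall i, ((A - W) *m (A - W)^T) i i <= q) ->
  \det (A *m A^T) <= 2 ^+ n * p ^+ m * q ^+ (n - m).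
Proof.
move=> /andP[rW mn] p0 q0 Ap AWq; have [U UU UW] := orthogonal_left_kernel rW.
have [n0|n_gt0] := posnP n.
  by subst n; move: mn; rewrite leqn0 => /eqP ->; rewrite det_mx00 !expr0 !mulr1.
have detU : \det U ^+ 2 = 1 by rewrite expr2 -{2}det_tr -det_mulmx UU det1.
have trU (C : 'M[R]_(n, N)) : \sum_i (U *m C *m (U *m C)^T) i i = \tr (C *m C^T).
  rewrite -/(\tr _) trmx_mul mulmxA mxtrace_mulC !mulmxA (mulmx1C UU).
  by rewrite mul1mx.
pose y i := (U *m A *m (U *m A)^T) i i.
have -> : \det (A *m A^T) = \det (U *m A *m (U *m A)^T).
  rewrite trmx_mul mulmxA -(mulmxA U) !det_mulmx det_tr.
  by rewrite mulrAC -!expr2 detU mul1r.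
apply: le_trans (hadamard_gram _) _; rewrite -/y.
(* AM-GM is applied to the squared row norms of [U *m A] divided by [w]. *)
pose w (i : 'I_n) := if (i < n - m)%N then q else p.
have w_gt0 i : 0 < w i by rewrite /w; case: ifP.
have prodw : \prod_i w i = p ^+ m * q ^+ (n - m).
  rewrite -(big_mkord predT (fun i => if (i < n - m)%N then q else p)).
  rewrite (big_cat_nat _ (leq_subr m n)) //= big_nat (eq_bigr (fun=> q)); last first.
    by move=> i /= ->.
  rewrite -big_nat prodr_const_nat subn0 mulrC big_nat (eq_bigr (fun=> p)); last first.
    by move=> i /andP[h _]; rewrite ltnNge h.
  by rewrite -big_nat prodr_const_nat subKn.
have -> : \prod_i (U *m A *m (U *m A)^T) i i = (\prod_i (y i / w i)) * \prod_i w i.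
  by rewrite -big_split; apply: eq_bigr => i _ /=; rewrite divfK // gt_eqF.
rewrite prodw mulrA -!mulrA ler_wpM2r //; first by rewrite mulr_ge0 // exprn_ge0 // ltW.
have y0 i : 0 <= y i / w i by rewrite divr_ge0 ?gram_diag_ge0 // ltW.
have [+ _] := @leif_AGM _ _ 'I_n (fun i => y i / w i) (fun i _ => y0 i).
move=> /le_trans; apply; rewrite card_ord lerXn2r ?nnegrE //.
  by rewrite divr_ge0 // sumr_ge0.
rewrite ler_pdivrMr ?ltr0n //.
(* Each [y i / w i] is at most the [i]-th terms of these two sums together, so the mean is at most
   2; hence the factor [2 ^+ n]. *)
have sumA : \sum_i y i / p <= n%:R.
  rewrite -mulr_suml trU ler_pdivrMr // mulr_natl -[n in _ *+ n]card_ord -sumr_const.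
  exact: ler_sum.
have sumAW : \sum_i (U *m (A - W) *m (U *m (A - W))^T) i i / q <= n%:R.
  rewrite -mulr_suml trU ler_pdivrMr // mulr_natl -[n in _ *+ n]card_ord -sumr_const.
  exact: ler_sum.
apply: le_trans (_ : _ <= n%:R + n%:R) _; last by lra.
apply: le_trans (lerD sumA sumAW); rewrite -big_split; apply: ler_sum => i _ /=.
rewrite /w; case: ifP => [im|_].
  rewrite (_ : y i = (U *m (A - W) *m (U *m (A - W))^T) i i).
    by rewrite lerDr divr_ge0 ?gram_diag_ge0 // ltW.
  rewrite /y !gram_diagE; apply: eq_bigr => j _; congr (_ ^+ 2).
  have /rowP/(_ j) := UW i im; rewrite -row_mul mxE [in RHS]mxE => h.
  by rewrite mulmxBr [RHS]mxE [(- (U *m W)) i j]mxE h subr0 mxE.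
by rewrite lerDl divr_ge0 ?gram_diag_ge0 // ltW.
Qed.
End Gram.

(** * Linear spans, dependence and dimension *)

Section Span.
Context {R : realType} {E : lmodType R}.
Implicit Types (A B V : set E).

Lemma lin_span_mem A x : A x -> lin_span A x.
Proof.
by move=> Ax; exists 1%N, (fun=> 1), (fun=> x); rewrite big_ord1 scale1r.
Qed.

Lemma lin_span0 A : lin_span A 0.
Proof. by exists 0%N, (fun=> 0), (fun=> 0); rewrite big_ord0; split=> // -[]. Qed.

Lemma lin_spanD A x y : lin_span A x -> lin_span A y -> lin_span A (x + y).
Proof.
move=> [n [a [v [Av ->]]]] [m [b [w [Aw ->]]]].
exists (n + m)%N, (fun i => match fintype.split i with inl j => a j | inr j => b j end),
  (fun i => match fintype.split i with inl j => v j | inr j => w j end); split.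
  by move=> i; case: (fintype.split i).
rewrite big_split_ord /=; congr (_ + _); apply: eq_bigr => i _.
  by rewrite (unsplitK (inl i)).
by rewrite (unsplitK (inr i)).
Qed.

Lemma lin_spanZ A (c : R) x : lin_span A x -> lin_span A (c *: x).
Proof.
move=> [n [a [v [Av ->]]]]; exists n, (fun i => c * a i), v; split=> //.
by rewrite scaler_sumr; apply: eq_bigr => i _; rewrite scalerA.
Qed.

Lemma lin_span_sum A (I : finType) (P : pred I) (a : I -> R) (v : I -> E) :
    (forall i, P i -> lin_span A (v i)) ->
  lin_span A (\sum_(i | P i) a i *: v i).
Proof.
move=> Av; elim/big_ind: _ => [|x y|i Pi]; first exact: lin_span0.
  exact: lin_spanD.
by apply: lin_spanZ; apply: Av.
Qed.

Lemma lin_spanB A x y : lin_span A x -> lin_span A y -> lin_span A (x - y).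
Proof. by move=> Ax Ay; rewrite -scaleN1r; apply/lin_spanD/lin_spanZ. Qed.

Lemma lin_span_sub A B : A `<=` lin_span B -> lin_span A `<=` lin_span B.
Proof. by move=> AB x [n [a [v [Av ->]]]]; apply: lin_span_sum => i _; apply: AB. Qed.

Lemma lin_span_rangeP n (v : 'I_n -> E) x :
  lin_span (range v) x -> exists a : 'I_n -> R, x = \sum_i a i *: v i.
Proof.
move=> [k [b [w [vw ->]]]]; elim/big_ind: _ => [|_ _ [a ->] [c ->]|j _].
- by exists (fun=> 0); rewrite big1 // => i _; rewrite scale0r.
- exists (fun i => a i + c i); rewrite -big_split.
  by apply: eq_bigr => i _; rewrite scalerDl.
- have [i _ <-] := vw j; exists (fun l => if l == i then b j else 0).
  rewrite (bigD1 i) //= eqxx big1 ?addr0 // => l /negPf ->.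
  by rewrite scale0r.
Qed.

(** The coefficient matrix of the [w j] has more rows than columns, hence a nonzero vector in its
    left kernel. *)
Lemma linear_relation n k (v : 'I_n -> E) (w : 'I_k -> E) : (n < k)%N ->
    (forall j, lin_span (range v) (w j)) ->
  exists u : 'I_k -> R, (exists j, u j != 0) /\ \sum_j u j *: w j = 0.
Proof.
move=> nk vw; have /choice[c wE] := fun j => lin_span_rangeP (vw j).
pose C := \matrix_(j, i) c j i.
have /rowV0Pn[u /sub_kermxP uC u0] : kermx C != 0.
  rewrite -mxrank_eq0 mxrank_ker -lt0n subn_gt0.
  exact: leq_ltn_trans (rank_leq_col _) nk.
exists (u 0); split.
  apply: contrapT => h; case/eqP: u0; apply/rowP => j; rewrite mxE.
  by apply: contrapT => /eqP uj; apply: h; exists j.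
under eq_bigr do rewrite wE scaler_sumr.
rewrite exchange_big big1 //= => i _.
under eq_bigr do rewrite scalerA.
rewrite -scaler_suml; have /rowP/(_ i) := uC; rewrite !mxE => h.
rewrite (_ : \sum_(j < k) u 0 j * c j i = 0) ?scale0r // -[RHS]h.
by apply: eq_bigr => j _; rewrite mxE.
Qed.

Lemma lin_indep_cons n (v : 'I_n -> E) (x : E) :
    lin_indep v -> ~ lin_span (range v) x ->
  lin_indep (fun i : 'I_n.+1 => oapp v x (unlift ord0 i)).
Proof.
move=> vi xv a; rewrite big_ord_recl unlift_none /=.
under eq_bigr do rewrite liftK /=.
move=> s0; have a0 : a ord0 = 0.
  apply: contrapT => /eqP a0; apply: xv.
  rewrite -[x](scalerK a0) (_ : a ord0 *: x = - \sum_(i < n) a (lift ord0 i) *: v i).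
    rewrite -scaleN1r; do 2 apply: lin_spanZ.
    by apply: lin_span_sum => i _; apply: lin_span_mem; exists i.
  by apply/eqP; rewrite -addr_eq0 s0.
rewrite a0 scale0r add0r in s0 => i.
by case: (unliftP ord0 i) => [j|] ->; [exact: (vi (fun i => a (lift ord0 i)))|].
Qed.

(** [gamma_] ranges over spaces of an exact dimension, while the vectors to be contained may be
    dependent: each redundant one is replaced by a new independent vector. *)
Lemma has_dim_superset (Einf : forall k, exists w : 'I_k -> E, lin_indep w)
    k (u : 'I_k -> E) :
  exists V, has_dim k V /\ forall i, V (u i).
Proof.
elim: k u => [|k IH] u.
  by exists (lin_span (range u)); split; [exists u; split=> // a _ []|case].
have [_ [[v [vi ->]] vu]] := IH (fun i => u (lift ord0 i)).
(* If [u ord0] brings nothing new, a vector outside the span still exists: [k + 1] independent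
   vectors cannot all lie in the span of [k]. *)
have [x [xv vx]] : exists x, ~ lin_span (range v) x /\
    (u ord0 = x \/ lin_span (range v) (u ord0)).
  have [h|h] := pselect (lin_span (range v) (u ord0)); last by exists (u ord0); auto.
  have [w wi] := Einf k.+1; apply: contrapT => nx.
  have [j|a [[j aj] sa]] := @linear_relation k k.+1 v w (ltnSn k).
    by apply: contrapT => wj; apply: nx; exists (w j); auto.
  by have := wi a sa j => /eqP; rewrite (negPf aj).
pose v' := (fun i : 'I_k.+1 => oapp v x (unlift ord0 i)).
have vv' : lin_span (range v) `<=` lin_span (range v').
  apply: lin_span_sub => _ [i _ <-]; apply: lin_span_mem.
  by exists (lift ord0 i) => //; rewrite /v' liftK.
exists (lin_span (range v')); split.
  by exists v'; split=> //; apply: lin_indep_cons.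
move=> i; case: (unliftP ord0 i) => [j|] ->; first exact/vv'/vu.
case: vx => [->|]; last exact: vv'.
by apply: lin_span_mem; exists ord0 => //; rewrite /v' unlift_none.
Qed.

End Span.

(** * Euclidean norms from the Banach-Mazur distance *)

Section Euclidean.
Context {R : realType} (X : normedModType R).

Lemma l2normZ n (c : R) (v : 'rV[R]_n) : 0 <= c -> l2norm (c *: v) = c * l2norm v.
Proof.
move=> c0; rewrite /l2norm; under eq_bigr do rewrite mxE exprMn.
by rewrite -mulr_sumr sqrtrM ?sqr_ge0 // sqrtr_sqr ger0_norm.
Qed.

Lemma l2norm_sqr n (v : 'rV[R]_n) : l2norm v ^+ 2 = (v *m v^T) 0 0.
Proof.
by rewrite gram_diagE sqr_sqrtr // sumr_ge0 // => i _; rewrite sqr_ge0.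
Qed.

Lemma l2norm_eq0 n (v : 'rV[R]_n) : l2norm v = 0 -> v = 0.
Proof. by move=> v0; apply: gram_row_eq0; rewrite -l2norm_sqr v0 expr0n. Qed.

Lemma opnorm_ge0 (E1 E2 : lmodType R) (N1 : E1 -> R) (N2 : E2 -> R)
    (V : set E1) (T : E1 -> E2) :
  V 0 -> N1 0 = 0 -> (forall y, 0 <= N2 y) -> (0 <= opnorm N1 N2 V T)%E.
Proof.
move=> V0 N10 N2p; apply: le_ereal_sup_tmp; exists (N2 (T 0))%:E.
  by exists 0 => //=; rewrite N10.
by rewrite lee_fin.
Qed.

Lemma opnorm_bound (E1 E2 : lmodType R) (N1 : E1 -> R) (N2 : E2 -> R)
    (V : set E1) (T : E1 -> E2) (M : R) :
    (forall x, 0 <= N1 x) -> (forall x, N1 x = 0 -> x = 0) ->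
    (forall c x, 0 <= c -> N1 (c *: x) = c * N1 x) ->
    (forall c x, 0 <= c -> N2 (c *: x) = c * N2 x) ->
    (forall c x, V x -> V (c *: x)) ->
    (forall c x, V x -> T (c *: x) = c *: T x) ->
    (opnorm N1 N2 V T <= M%:E)%E ->
  forall x, V x -> N2 (T x) <= M * N1 x.
Proof.
move=> N1p N10 N1Z N2Z VZ TZ /ereal_supP TM x Vx.
have [n0|n0] := eqVneq (N1 x) 0.
  rewrite n0 mulr0 (_ : T x = 0 *: T x) ?N2Z ?mul0r //.
  by rewrite -TZ // (N10 _ n0) scaler0.
have n_gt0 : 0 < N1 x by rewrite lt_def n0 N1p.
rewrite -ler_pdivrMr // mulrC -N2Z ?invr_ge0 // -TZ // -lee_fin.
apply: TM; exists ((N1 x)^-1 *: x) => //=; split; first exact: VZ.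
by rewrite N1Z ?invr_ge0 // mulVf.
Qed.

(** Multiplying [T] by the norm [q] of its inverse makes the lower constant 1 and the upper one
    [p q < c]. *)
Lemma banach_mazur_l2_lt n (V : set X) (c : R) : (0 < n)%N -> has_dim n V ->
    (banach_mazur_l2 n V < c%:E)%E ->
  exists T : X -> 'rV[R]_n,
    (forall (a : R) x y, V x -> V y -> T (a *: x + y) = a *: T x + T y) /\
    (forall x, V x -> `|x| <= l2norm (T x) <= c * `|x|).
Proof.
move=> n0 [v [_ VE]] /ereal_inf_lt[_ [T [S [[Tl TV SV ST TS] ->]]]] TSc.
have V0 : V 0 by rewrite VE; apply: lin_span0.
have VZ a x : V x -> V (a *: x) by rewrite VE; apply: lin_spanZ.
have T0 : T 0 = 0.
  by have := Tl (-1) 0 0 V0 V0; rewrite scaler0 addr0 scaleN1r addNr.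
have TZ a x : V x -> T (a *: x) = a *: T x.
  by move=> Vx; rewrite -[a *: x]addr0 Tl // T0 addr0.
have SZ a y : [set: 'rV[R]_n] y -> S (a *: y) = a *: S y.
  by move=> _; rewrite -{1}[y]TS // -TZ ?ST //; [apply: VZ|]; apply: SV.
have l2ge0 (y : 'rV[R]_n) : 0 <= l2norm y by rewrite sqrtr_ge0.
have l20 : l2norm (0 : 'rV[R]_n) = 0 by rewrite -(scale0r 0) l2normZ // mul0r.
have nZ (a : R) (x : X) : 0 <= a -> `|a *: x| = a * `|x|.
  by move=> a0; rewrite normrZ ger0_norm.
pose p := opnorm (fun x : X => `|x|) (@l2norm R n) V T.
pose q := opnorm (@l2norm R n) (fun x : X => `|x|) [set: 'rV[R]_n] S.
have p0 : (0 <= p)%E by apply: opnorm_ge0 => //; rewrite normr0.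
have q0 : (0 <= q)%E by apply: opnorm_ge0.
have pT M : (p <= M%:E)%E -> forall x, V x -> l2norm (T x) <= M * `|x|.
  apply: opnorm_bound => //; first by move=> x /normr0_eq0.
  by move=> a x; apply: l2normZ.
have qS M : (q <= M%:E)%E -> forall y, `|S y| <= M * l2norm y.
  move=> qM y; apply: (@opnorm_bound _ _ (@l2norm R n) (fun x : X => `|x|) setT) => //.
    by move=> x; apply: l2norm_eq0.
  by move=> a x; apply: l2normZ.
(* A nonzero vector, available since [0 < n], shows that both norms are nonzero; an infinite one
   would then make the product infinite, against [TSc]. *)
pose e : 'rV[R]_n := const_mx 1.
have e0 : e != 0.
  apply/eqP => /rowP/(_ (Ordinal n0)); rewrite !mxE => /eqP.
  by rewrite oner_eq0.
have ne0 : l2norm e != 0 by apply: contra_neq e0; apply: l2norm_eq0.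
have p_neq0 : p != 0%E.
  apply/eqP => pz; have := pT 0; rewrite pz lexx => /(_ isT (S e) (SV _ I)).
  by rewrite TS // mul0r le_eqVlt ltNge l2ge0 orbF (negPf ne0).
have q_neq0 : q != 0%E.
  apply/eqP => qz; have := qS 0; rewrite qz lexx => /(_ isT e).
  rewrite mul0r normr_le0 => /eqP Se; have := TS e I.
  by rewrite Se T0 => /esym/eqP; rewrite (negPf e0).
have p_gt0 : (0 < p)%E by rewrite lt_def p_neq0.
have q_gt0 : (0 < q)%E by rewrite lt_def q_neq0.
rewrite -/p -/q in TSc.
have pfin : p \is a fin_num.
  rewrite ge0_fin_numE // ltNge leye_eq; apply/negP => /eqP pE.
  by move: TSc; rewrite pE gt0_mulye.
have qfin : q \is a fin_num.
  rewrite ge0_fin_numE // ltNge leye_eq; apply/negP => /eqP qE.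
  by move: TSc; rewrite qE gt0_muley.
move: TSc; rewrite -(fineK pfin) -(fineK qfin) -EFinM lte_fin => pqc.
have {}pT : forall x, V x -> l2norm (T x) <= fine p * `|x|.
  by apply: pT; rewrite fineK.
have {}qS : forall y, `|S y| <= fine q * l2norm y by apply: qS; rewrite fineK.
have {}q0 : 0 <= fine q by rewrite fine_ge0.
exists (fun x => fine q *: T x); split=> [a x y Vx Vy|x Vx].
  by rewrite Tl // scalerDr !scalerA mulrC.
rewrite l2normZ //; apply/andP; split; first by rewrite -{1}[x]ST //; apply: qS.
apply: le_trans (_ : fine q * (fine p * `|x|) <= _); first by apply: ler_wpM2l => //; apply: pT.
by rewrite mulrA ler_wpM2r // mulrC ltW.
Qed.

End Euclidean.

(** * The modulus of smoothness and the norm of one greedy step *)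

Section Smoothness.
Context {R : realType} (X : normedModType R) (x0 : X).
Context (x0_unit : `|x0| = 1).
Implicit Types (u v c : R) (x y : X).

Lemma smoothness_ge u x y : `|x| = 1 -> `|y| = 1 ->
  (`|x + u *: y| + `|x - u *: y|) / 2 <= 1 + smoothness X u.
Proof.
move=> x1 y1; rewrite /smoothness addrCA subrr addr0; apply: ub_le_sup; last by exists x, y.
exists (1 + `|u|) => _ [a [b [a1 b1 ->]]].
have := ler_normD a (u *: b); have := ler_normB a (u *: b).
by rewrite normrZ a1 b1 mulr1 => h1 h2; lra.
Qed.

Lemma smoothness_le u c :
    (forall x y, `|x| = 1 -> `|y| = 1 ->
      (`|x + u *: y| + `|x - u *: y|) / 2 <= 1 + c) ->
  smoothness X u <= c.
Proof.
move=> h; rewrite /smoothness lerBlDl; apply: ge_sup.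
  by exists ((`|x0 + u *: x0| + `|x0 - u *: x0|) / 2), x0, x0.
by move=> _ [x [y [x1 y1 ->]]]; apply: h.
Qed.

(** Convexity: [x + u y] and [x - u y] are convex combinations of [x] with [x + v y] and [x - v y],
    with weight [u / v] on the latter. *)
Lemma smoothness_slope u v : 0 <= u <= v -> 0 < v ->
  smoothness X u <= u / v * smoothness X v.
Proof.
move=> /andP[u0 uv] v0; apply: smoothness_le => x y x1 y1.
set t := u / v; have t0 : 0 <= t by rewrite divr_ge0 // ltW.
have t1 : t <= 1 by rewrite ler_pdivrMr // mul1r.
have tv : t * v = u by rewrite divfK // gt_eqF.
clearbody t.
have hp : `|x + u *: y| <= (1 - t) + t * `|x + v *: y|.
  have -> : x + u *: y = (1 - t) *: x + t *: (x + v *: y).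
    by rewrite scalerDr scalerA tv addrA -scalerDl subrK scale1r.
  apply: le_trans (ler_normD _ _) _; rewrite !normrZ x1 mulr1.
  by rewrite !ger0_norm // subr_ge0.
have hm : `|x - u *: y| <= (1 - t) + t * `|x - v *: y|.
  have -> : x - u *: y = (1 - t) *: x + t *: (x - v *: y).
    by rewrite scalerBr scalerA tv addrA -scalerDl subrK scale1r.
  apply: le_trans (ler_normD _ _) _; rewrite !normrZ x1 mulr1.
  by rewrite !ger0_norm // subr_ge0.
have := ler_wpM2l t0 (smoothness_ge v x1 y1); lra.
Qed.

Lemma smoothness_lipschitz u v : smoothness X u <= smoothness X v + `|u - v|.
Proof.
apply: smoothness_le => x y x1 y1.
have := smoothness_ge v x1 y1.
have hp : `|x + u *: y| <= `|x + v *: y| + `|u - v|.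
  have -> : x + u *: y = (x + v *: y) + (u - v) *: y.
    by rewrite -addrA -scalerDl [v + _]addrC subrK.
  by apply: le_trans (ler_normD _ _) _; rewrite normrZ y1 mulr1.
have hm : `|x - u *: y| <= `|x - v *: y| + `|u - v|.
  have -> : x - u *: y = (x - v *: y) - (u - v) *: y.
    by rewrite -addrA -opprD -scalerDl [v + _]addrC subrK.
  by apply: le_trans (ler_normB _ _) _; rewrite normrZ y1 mulr1.
lra.
Qed.

(** With [u = mu^-1] the equation reads [h u = 0]; the intermediate value theorem gives a zero
    between 1 and 3. *)
Lemma smoothness_muP : 0 < smoothness_mu X <= 1 /\
  1 + smoothness_mu X = 2 * smoothness_mu X * smoothness X (smoothness_mu X)^-1.
Proof.
suff [mu muP] : exists mu, 0 < mu <= 1 /\ 1 + mu = 2 * mu * smoothness X mu^-1.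
  by apply: (@xgetPex _ 0 [set mu | 0 < mu <= 1 /\
    1 + mu = 2 * mu * smoothness X mu^-1]); exists mu.
pose h u := smoothness X u - (u + 1) / 2.
have h_cont : continuous h.
  have rho_cont : continuous (smoothness X).
    move=> u; apply/cvgrPdist_le => e e0; near=> v.
    have uv : `|u - v| <= e by near: v; apply: cvgr_dist_le.
    have := smoothness_lipschitz u v; have := smoothness_lipschitz v u.
    by rewrite distrC => h1 h2; rewrite ler_norml; apply/andP; split; lra.
  move=> u; apply: cvgB; first exact: rho_cont.
  by apply: cvgM; [apply: cvgD; [exact: cvg_id|exact: cvg_cst]|exact: cvg_cst].
have h1 : h 1 <= 0.
  suff : smoothness X 1 <= 1 by rewrite /h; lra.
  apply: smoothness_le => x y x1 y1; rewrite scale1r.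
  by have := ler_normD x y; have := ler_normB x y; rewrite x1 y1; lra.
(* For [x = y = x0] the two norms are 4 and 2, whence [smoothness X 3 >= 2]. *)
have h3 : 0 <= h 3.
  have := smoothness_ge 3 x0_unit x0_unit.
  rewrite -[X in `|X + _|]scale1r -[X in `|X - _|]scale1r -scalerDl -scalerBl.
  rewrite !normrZ x0_unit !mulr1 ger0_norm; last by lra.
  by rewrite ler0_norm /h; lra.
have [|||c c13 hc] := @IVT _ h 1 3 0; first by lra.
- exact: continuous_subspaceT.
- by rewrite ge_min h1 le_max h3 orbT.
have {c13}[c1 c3] : 1 <= c /\ c <= 3.
  by move: c13; rewrite in_itv /= => /andP[].
have c0 : 0 < c by lra.
exists c^-1; rewrite invr_gt0 c0 invf_le1 // c1; split=> //.
rewrite invrK (_ : smoothness X c = (c + 1) / 2); last by move: hc; rewrite /h; lra.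
by field; rewrite gt_eqF.
Unshelve. all: by end_near.
Qed.

Lemma R_const_ge1 : 1 <= R_const X.
Proof. by have [/andP[mu0 _] _] := smoothness_muP; rewrite lerDl ltW. Qed.

Lemma norming_functional_le (g : X) (phi : {linear X -> R^o}) x :
  norming_functional g phi -> `|phi x : R| <= `|x|.
Proof.
move=> [_ phi1 _]; rewrite -[leRHS]mul1r.
apply: (@opnorm_bound _ _ _ (fun x : X => `|x|) (fun r : R^o => `|r|) setT) => //.
- by move=> y /normr0_eq0.
- by move=> c y c0; rewrite normrZ ger0_norm.
- by move=> c y c0; rewrite normrZ ger0_norm.
- by move=> c y _; rewrite linearZ.
- by rewrite -/(dual_norm phi) phi1.
Qed.

(* The norm is at most [1 + a] and at most [2 a smoothness (a^-1)], where
   [a := phi x] for a unit vector [x]: the first bound increases with [a], the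
   second one decreases, and they cross at [a = smoothness_mu X]. *)
Lemma norm_sub_norming_le (g : X) (phi : {linear X -> R^o}) x :
    `|g| = 1 -> norming_functional g phi ->
  `|x - (phi x : R) *: g| <= R_const X * `|x|.
Proof.
move=> g1 gphi; have phig : phi g = 1 by case: gphi => _ _ ->.
have phi_le y := norming_functional_le y gphi.
suff unit_case y : `|y| = 1 -> 0 <= (phi y : R) -> `|y - (phi y : R) *: g| <= R_const X.
  have [->|xn0] := eqVneq x 0; first by rewrite linear0 scale0r subr0 normr0 mulr0.
  have nx_gt0 : 0 < `|x| by rewrite normr_gt0.
  pose e : R := if 0 <= (phi x : R) then 1 else -1.
  have e1 : `|e| = 1 by rewrite /e; case: ifP; rewrite ?normrN normr1.
  pose y := (e / `|x|) *: x.
  have y1 : `|y| = 1 by rewrite normrZ normrM e1 mul1r normfV normr_id mulVf ?gt_eqF.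
  have phiy : phi y = e / `|x| * (phi x : R) by rewrite linearZ.
  have := unit_case y y1; rewrite phiy -scalerA -scalerBr.
  rewrite normrZ normrM e1 mul1r normfV normr_id [_^-1 * _]mulrC ler_pdivrMr //; apply.
  rewrite mulrAC divr_ge0 // /e; case: ifP => [|/negbT]; first by rewrite mul1r.
  by rewrite -ltNge => h; rewrite mulN1r oppr_ge0 ltW.
move=> y1 a0; set a : R := phi y; have a1 : a <= 1.
  by apply: le_trans (ler_norm a) _; rewrite -y1; apply: phi_le.
have [/andP[mu0 mu1] muE] := smoothness_muP.
have [amu|mua] := lerP a (smoothness_mu X).
  apply: le_trans (ler_normB _ _) _; rewrite normrZ g1 y1 mulr1 ger0_norm //.
  by rewrite /R_const lerD2l.
have a_gt0 : 0 < a by apply: lt_trans mua.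
(* As [a^-1 <= mu^-1], the slope bound compares [a * smoothness X a^-1] with the same expression at
   [mu]. *)
have rho_a : 2 * a * smoothness X a^-1 <= R_const X.
  have := @smoothness_slope a^-1 (smoothness_mu X)^-1.
  rewrite invr_ge0 a0 lef_pV2 ?posrE // ltW // invr_gt0 mu0 => /(_ isT isT).
  rewrite invrK => /(ler_wpM2l (mulr_ge0 (ler0n R 2) a0)) h.
  apply: le_trans h _; rewrite /R_const muE le_eqVlt; apply/orP; left; apply/eqP.
  by field; rewrite gt_eqF.
apply: le_trans rho_a.
have -> : y - a *: g = (- a) *: (g - a^-1 *: y).
  by rewrite scalerBr scalerA mulNr divff ?gt_eqF // scaleNr scaleN1r opprK addrC.
rewrite normrZ normrN ger0_norm // [2 * a]mulrC -mulrA; apply: ler_wpM2l => //.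
have := smoothness_ge a^-1 g1 y1.
(* [phi] takes the value 2 at this vector. The smoothness bound then leaves at most
   [2 * smoothness X a^-1] for the norm of [g - a^-1 y]. *)
have : 2 <= `|g + a^-1 *: y|.
  apply: le_trans (phi_le _); apply: le_trans (ler_norm _).
  by rewrite linearD linearZ /= phig [_ *: _]mulVf ?gt_eqF.
lra.
Qed.

End Smoothness.

(** * Distances and Kolmogorov widths *)

Section Distance.
Context {R : realType} (X : normedModType R).
Implicit Types (F V W : set X).

Lemma dist_lt_ex x V (d : R) : (dist x V < d%:E)%E -> exists2 v, V v & `|x - v| < d.
Proof. by move=> /ereal_inf_lt[_ [v Vv <-]]; rewrite lte_fin; exists v. Qed.

Lemma dist_le x V v : V v -> (dist x V <= `|x - v|%:E)%E.
Proof. by move=> Vv; apply: ereal_inf_lbound; exists v. Qed.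

Lemma dist_ge0 x V : (0 <= dist x V)%E.
Proof. by apply/ereal_infP => _ [v _ <-]; rewrite lee_fin. Qed.

Lemma deviation_ge0 F V : F !=set0 -> (0 <= deviation F V)%E.
Proof.
move=> [x Fx]; apply: le_ereal_sup_tmp; exists (dist x V); first by exists x.
exact: dist_ge0.
Qed.

Lemma kolmogorov_width_lt_ex m F (d : R) : (kolmogorov_width m F < d%:E)%E ->
  exists V, has_dim m V /\ forall x, F x -> exists2 v, V v & `|x - v| < d.
Proof.
move=> /ereal_inf_lt[_ [V mV <-]] Vd; exists V; split=> // x Fx.
apply: dist_lt_ex; apply: le_lt_trans Vd; apply: ereal_sup_ubound.
by exists x.
Qed.

End Distance.

(** * Residuals of the algorithm and their bounds *)

Section NaturalGreedy.
Context {R : realType} (X : normedModType R) (F : set X).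
Context (f g : nat -> X) (phi : nat -> {linear X -> R^o}).
Context (fg_nga : nga_realization F f g phi).

Local Notation Res := (nga_residual g phi).
Local Notation tau k := (`|Res k (f k)|).

Lemma nga_residual_linear k a x y : Res k (a *: x + y) = a *: Res k x + Res k y.
Proof.
elim: k => //= k ->; rewrite linearP /= scalerDl scalerBr !scalerA.
by rewrite opprD addrACA.
Qed.

Lemma nga_residual0 k : Res k 0 = 0.
Proof. by have := nga_residual_linear k (-1) 0 0; rewrite scaler0 addr0 scaleN1r addNr. Qed.

Lemma nga_residual_sum k (I : finType) (P : pred I) (a : I -> R) (v : I -> X) :
  Res k (\sum_(i | P i) a i *: v i) = \sum_(i | P i) a i *: Res k (v i).
Proof.
elim/big_rec2: _ => [|i y z _ <-]; first exact: nga_residual0.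
by rewrite nga_residual_linear.
Qed.

Lemma nga_norming k : norming_functional (g k) (phi k).
Proof. by case: (fg_nga k). Qed.

Lemma nga_memF k : F (f k).
Proof. by case: (fg_nga k). Qed.

Lemma nga_residual_max k h : F h -> `|Res k h| <= tau k.
Proof. by case: (fg_nga k) => _ + _ _; apply. Qed.

(** A zero residual would make [g k] zero, which excludes a norming functional. *)
Lemma nga_tau_gt0 k : 0 < tau k.
Proof.
rewrite normr_gt0; apply/eqP => z; case: (fg_nga k) => _ _ gk [/eqP + _ _]; apply.
by rewrite gk z scaler0.
Qed.

Lemma nga_norm_g k : `|g k| = 1.
Proof.
case: (fg_nga k) => _ _ -> _.
by rewrite normrZ normfV normr_id mulVf // gt_eqF // nga_tau_gt0.
Qed.

Lemma nga_residual_f k : Res k (f k) = tau k *: g k.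
Proof.
by case: (fg_nga k) => _ _ -> _; rewrite scalerA mulfV ?scale1r // gt_eqF // nga_tau_gt0.
Qed.

Lemma nga_phi_residual_f k : phi k (Res k (f k)) = tau k.
Proof.
have [_ _ pg] := nga_norming k.
by rewrite [in LHS]nga_residual_f linearZ /= pg nga_norm_g [LHS]mulr1.
Qed.

(** Step [i] removes [Res i (f i)] entirely, since it is a multiple of [g i] and [phi i] equals 1 at
    [g i]. *)
Lemma nga_residual_lt i k : (i < k)%N -> Res k (f i) = 0.
Proof.
elim: k => // k IH; rewrite ltnS leq_eqVlt => /predU1P[->|ik] /=.
  by rewrite nga_phi_residual_f -nga_residual_f subrr.
by rewrite IH // linear0 scale0r subr0.
Qed.

Lemma nga_residual_unitriangular (n : nat) (c : 'I_n -> R) (k : 'I_n) :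
    c k = 1 -> (forall j : 'I_n, (k < j)%N -> c j = 0) ->
  Res k (\sum_(j < n) c j *: f j) = tau k *: g k.
Proof.
move=> ck cj; rewrite nga_residual_sum (bigD1 k) //= ck scale1r big1.
  by rewrite addr0; apply: nga_residual_f.
move=> j jk; case: (ltngtP j k) => [jk'|kj|/val_inj jk'].
- by rewrite nga_residual_lt // scaler0.
- by rewrite cj // scale0r.
- by rewrite jk' eqxx in jk.
Qed.

Lemma nga_residual_expand k x :
  x = \sum_(j < k) (phi j (Res j x) : R) *: g j + Res k x.
Proof.
elim: k => [|k IH]; first by rewrite big_ord0 add0r.
by rewrite big_ord_recr /= -addrA subrKC -IH.
Qed.

Lemma nga_spaceS k : nga_space f k `<=` nga_space f k.+1.
Proof.
apply: lin_span_sub => _ [j /= jk <-]; apply: lin_span_mem.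
by exists j => //=; rewrite ltnS ltnW.
Qed.

Lemma nga_space_le i k : (i <= k)%N -> nga_space f i `<=` nga_space f k.
Proof.
move=> ik; apply: lin_span_sub => _ [j /= ji <-]; apply: lin_span_mem.
by exists j => //=; apply: leq_trans ik.
Qed.

(** Each step subtracts a multiple of [g k], and [g k] is proportional to [f k] minus an element of
    [nga_space f k]. *)
Lemma nga_sub_residual k x : nga_space f k (x - Res k x).
Proof.
elim: k x => [|k IH] x; first by rewrite /= subrr; apply: lin_span0.
rewrite /= opprB addrCA addrC; apply: lin_spanD; first exact/nga_spaceS/IH.
apply: lin_spanZ; rewrite (_ : g k = (tau k)^-1 *: Res k (f k)); last first.
  by case: (fg_nga k).
apply: lin_spanZ; rewrite -[Res k _](subKr (f k)); apply: lin_spanB.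
  by apply: lin_span_mem; exists k => /=.
exact/nga_spaceS/IH.
Qed.

(** [h - Res k h] approximates [h] from the space with error [Res k h], which the greedy choice
    bounds. *)
Lemma nga_sigma_le_tau n k : (k <= n)%N -> (nga_sigma F f n <= (tau k)%:E)%E.
Proof.
move=> kn; apply/ereal_supP => _ [h Fh <-].
have := dist_le h (nga_space_le kn (nga_sub_residual k h)).
by rewrite subKr => /le_trans; apply; rewrite lee_fin nga_residual_max.
Qed.

Lemma nga_lin_indep n : lin_indep (fun i : 'I_n => f i).
Proof.
(* [k] counts the top indices already settled: [Res i] kills the terms below [i], and the
   coefficients above [i] vanish by induction. *)
move=> a s0; suff h k (i : 'I_n) : (n - k <= i)%N -> a i = 0.
  by move=> i; apply: (h n); rewrite subnn.
elim: k i => [|k IH] i; first by rewrite subn0 leqNgt ltn_ord.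
move=> ki; case: (ltnP i (n - k)%N) => [ik|]; last exact: IH.
have := congr1 (Res i) s0; rewrite nga_residual0 nga_residual_sum (bigD1 i) //= big1.
  rewrite addr0 => /eqP; rewrite scaler_eq0 => /orP[/eqP//|].
  by rewrite -normr_eq0 gt_eqF // nga_tau_gt0.
move=> j ji; case: (ltngtP j i) => [ji'|ij|/val_inj ji'].
- by rewrite nga_residual_lt // scaler0.
- by rewrite IH ?scale0r //; lia.
- by rewrite ji' eqxx in ji.
Qed.

Lemma nga_residual_le_R k x : `|Res k x| <= R_const X ^+ k * `|x|.
Proof.
elim: k x => [|k IH] x; first by rewrite expr0 mul1r.
have R0 : 0 <= R_const X.
  by apply: le_trans (R_const_ge1 (nga_norm_g 0)); rewrite ler01.
apply: le_trans (norm_sub_norming_le (nga_norm_g 0) _ (nga_norm_g k) (nga_norming k)) _.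
by rewrite exprS -mulrA ler_wpM2l.
Qed.

Lemma basis_constant_ge0 : (0 <= basis_constant g)%E.
Proof.
apply: le_ereal_sup_tmp; exists (partial_sum_norm g 1); first by exists 1%N.
apply: le_ereal_sup_tmp; exists 0%E => //.
exists 0%N, (fun=> 0); rewrite !big_ord0 normr0; split=> //; exact: ler01.
Qed.

Lemma partial_sum_le (C : R) N (a : nat -> R) k : (basis_constant g <= C%:E)%E ->
    (0 < k)%N ->
  `|\sum_(j < N | (j < k)%N) a j *: g j| <= C * `|\sum_(j < N) a j *: g j|.
Proof.
move=> gC k0.
have scaled t : `|\sum_(j < N) (t * a j) *: g j| <= 1 ->
    `|\sum_(j < N | (j < k)%N) (t * a j) *: g j| <= C.
  move=> t1; rewrite -lee_fin; apply: le_trans gC.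
  apply: (@le_trans _ _ (partial_sum_norm g k)).
    by apply: ereal_sup_ubound; exists N, (fun j => t * a j).
  by apply: ereal_sup_ubound; exists k.
have scaleE t (P : pred 'I_N) :
    \sum_(j < N | P j) (t * a j) *: g j = t *: \sum_(j < N | P j) a j *: g j.
  by rewrite scaler_sumr; apply: eq_bigr => j _; rewrite scalerA.
set x := \sum_(j < N) _; set y := \sum_(j < N | _) _.
have {}scaled (t : R) : `|t| * `|x| <= 1 -> `|t| * `|y| <= C.
  by have := scaled t; rewrite !scaleE !normrZ.
have [x0|x0] := eqVneq `|x| 0.
  rewrite x0 mulr0 leNgt; apply/negP => y0.
  have C0 : 0 <= C by rewrite -lee_fin (le_trans basis_constant_ge0).
  (* When [x] vanishes every multiple is admissible; this one would have a partial sum of norm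
     [C + 1]. *)
  have := scaled ((C + 1) / `|y|); rewrite x0 mulr0 ler01 => /(_ isT).
  rewrite normrM normfV normr_id divfK ?gt_eqF // ger0_norm; last by lra.
  by lra.
have x_gt0 : 0 < `|x| by rewrite lt_def x0 /=.
have := scaled (`|x|^-1); rewrite normfV normr_id mulVf // => /(_ (lexx _)).
by rewrite mulrC ler_pdivrMr.
Qed.

(** The combination [x] is killed by [Res k.+1], so it is a combination of [g 0], ..., [g k], and
    [Res k x] is [x] minus its [k]-th partial sum. *)
Lemma nga_tau_le_basis_constant (C : R) n (c : 'I_n -> R) (k : 'I_n) :
    (basis_constant g <= C%:E)%E ->
    c k = 1 -> (forall j : 'I_n, (k < j)%N -> c j = 0) ->
  tau k <= (C + 1) * `|\sum_(j < n) c j *: f j|.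
Proof.
move=> gC ck cj; have := nga_residual_unitriangular ck cj.
set x := \sum_(j < n) _ => xk.
have C0 : 0 <= C by rewrite -lee_fin (le_trans basis_constant_ge0).
have -> : tau k = `|Res k x| by rewrite xk -nga_residual_f.
have xk1 : Res k.+1 x = 0.
  by rewrite /= xk -nga_residual_f nga_phi_residual_f -nga_residual_f subrr.
rewrite mulrDl mul1r addrC.
(* The basis constant only involves partial sums of length at least 1; for [k = 0] the residual is
   [x] itself. *)
have [k0|k0] := posnP k.
  by rewrite k0 /= lerDl mulr_ge0.
have rE : Res k x = x - \sum_(j < k) (phi j (Res j x) : R) *: g j.
  by rewrite {2}(nga_residual_expand k x) addrAC subrr add0r.
rewrite rE; apply: le_trans (ler_normB _ _) _; rewrite lerD2l.
have := @partial_sum_le C k.+1 (fun j => phi j (Res j x)) k gC k0.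
rewrite [X in C * `|X|](_ : _ = x); last first.
  by rewrite [RHS](nga_residual_expand k.+1 x) xk1 addr0.
by rewrite big_mkcond big_ord_recr /= ltnn addr0 -big_mkcond /=
  (eq_bigl xpredT) // => j; rewrite ltn_ord.
Qed.

(** Quantitative independence: [Res n] isolates the last coefficient, and the induction hypothesis
    handles the combination without its last term. *)
Lemma nga_lower_bound n : exists2 e : R, 0 < e &
  forall a : nat -> R, e * (\sum_(i < n) `|a i|) <= `|\sum_(i < n) a i *: f i|.
Proof.
elim: n => [|n [e e0 IH]]; first by exists 1 => // a; rewrite !big_ord0 mulr0.
have Rn0 : 0 < R_const X ^+ n.
  by rewrite exprn_gt0 // (lt_le_trans ltr01 (R_const_ge1 (nga_norm_g 0))).
(* [K] bounds the last coefficient, and [M - K] the sum of the others, relative to the norm of the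
   combination. *)
pose K := R_const X ^+ n / tau n.
have K0 : 0 < K by rewrite divr_gt0 // nga_tau_gt0.
pose M := K + (1 + K * `|f n|) / e.
have M0 : 0 < M.
  by rewrite addr_gt0 // divr_gt0 // ltr_wpDr // mulr_ge0 // ltW.
exists M^-1 => [|a]; first by rewrite invr_gt0.
set x := \sum_(i < n.+1) a i *: f i; rewrite mulrC ler_pdivrMr // [`|x| * _]mulrC.
have an : `|a n| <= K * `|x|.
  rewrite /K mulrAC ler_pdivlMr ?nga_tau_gt0 //. apply: le_trans (nga_residual_le_R n x).
  rewrite /x nga_residual_sum big_ord_recr /= big1 ?add0r ?normrZ //.
  by move=> i _; rewrite nga_residual_lt ?scaler0.
rewrite big_ord_recr /= /M mulrDl addrC; apply: lerD => //.
rewrite mulrAC ler_pdivlMr // mulrC; apply: le_trans (IH a) _.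
have -> : \sum_(i < n) a i *: f i = x - a n *: f n by rewrite /x big_ord_recr /= addrK.
apply: le_trans (ler_normB _ _) _; rewrite normrZ mulrDl mul1r lerD2l mulrAC.
by rewrite ler_wpM2r.
Qed.

(* Positivity matters because [+oo * 0 = 0] in [\bar R]: with width [0], an
   infinite [gamma_] would make the right-hand side of the theorem vanish. *)
Lemma kolmogorov_width_gt0 m : (0 < kolmogorov_width m F)%E.
Proof.
have [e e0 eP] := nga_lower_bound m.+1.
apply: (@lt_le_trans _ _ e%:E); first by rewrite lte_fin.
rewrite leNgt; apply/negP => /kolmogorov_width_lt_ex[V [[v [_ VE]] FV]].
have /choice[w wP] : forall i : 'I_m.+1, exists w, V w /\ `|f i - w| < e.
  by move=> i; have [w Vw fw] := FV _ (nga_memF i); exists w.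
(* The [m + 1] approximants in an [m]-dimensional space are dependent; in their relation, replacing
   [w i] by [f i - w i] gives a combination too small for the lower bound. *)
have [|u [[j uj] su]] := @linear_relation R X m m.+1 v w (ltnSn m).
  by move=> i; rewrite -VE; case: (wP i).
pose a i := oapp u 0 (insub i).
have aE (i : 'I_m.+1) : a i = u i by rewrite /a valK.
have := eP a; under eq_bigr do rewrite aE.
under [in X in _ <= X -> _]eq_bigr do rewrite aE.
have -> : \sum_(i < m.+1) u i *: f i = \sum_(i < m.+1) u i *: (f i - w i).
  by under [RHS]eq_bigr do rewrite scalerBr; rewrite sumrB su subr0.
apply/negP; rewrite -ltNge; apply: le_lt_trans (ler_norm_sum _ _ _) _.
rewrite mulr_sumr (bigD1 j) //= [ltRHS](bigD1 j) //=; apply: ltr_leD.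
  rewrite normrZ mulrC ltr_pM2r ?normr_gt0 //.
  by case: (wP j).
apply: ler_sum => i _; rewrite normrZ mulrC ler_wpM2r // ltW //.
by case: (wP i).
Qed.

End NaturalGreedy.

(** * The volume comparison *)

Section Volume.
Context {R : realType} (X : normedModType R) (F : set X).
Context (f g : nat -> X) (phi : nat -> {linear X -> R^o}).
Context (fg_nga : nga_realization F f g phi).
Context (F_ball : F `<=` [set x | `|x| <= 1]).

Local Notation Res := (nga_residual g phi).
Local Notation tau k := (`|Res k (f k)|).

Lemma kolmogorov_width_le1 m : (kolmogorov_width m F <= 1)%E.
Proof.
pose V := lin_span (range (fun i : 'I_m => f i)).
apply: (@le_trans _ _ (deviation F V)).
  apply: ereal_inf_lbound; exists V => //.
  by exists (fun i : 'I_m => f i); split=> //; apply: nga_lin_indep fg_nga m.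
apply/ereal_supP => _ [x Fx <-]; apply: le_trans (dist_le x (lin_span0 _)) _.
by rewrite subr0 lee_fin; apply: F_ball.
Qed.

Lemma nga_sigma_fin_num n : nga_sigma F f n \is a fin_num.
Proof.
have s_ge0 : (0 <= nga_sigma F f n)%E.
  by apply: deviation_ge0; exists (f 0); apply: nga_memF fg_nga 0%N.
rewrite ge0_fin_numE //; apply: le_lt_trans (nga_sigma_le_tau fg_nga (leq0n n)) _.
exact: ltry.
Qed.

(** Common form of the two residual bounds, so that the volume argument is run once; the
    coefficients are those of a row of a unitriangular matrix. *)
Definition nga_coef_bound n (b : 'I_n -> R) := forall (k : 'I_n) (a : 'I_n -> R),
  a k = 1 -> (forall j : 'I_n, (k < j)%N -> a j = 0) ->
  tau k <= b k * `|\sum_(j < n) a j *: f j|.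

(** Square root of the comparison between the two bounds on the Gram determinant. The conclusion
    [0 < c] later excludes [gamma_ X (n + m) = -oo]. *)
Lemma nga_volume n m (V : set X) (b : 'I_n -> R) (c d s : R) :
    (0 < m < n)%N -> has_dim m V ->
    (forall x, F x -> exists2 w, V w & `|x - w| < d) ->
    (gamma_ X (n + m) < c%:E)%E ->
    nga_coef_bound b -> (forall k, 0 <= b k) -> 0 <= s ->
    (forall k : 'I_n, s <= tau k) ->
  0 < c /\ s ^+ n <= (\prod_k b k) * ((Num.sqrt 2 * c) ^+ n * d ^+ (n - m)).
Proof.
move=> /andP[m0 mn] [v [_ VE]] FV gc bP b0 s0 s_tau.
have n0 : (0 < n)%N by apply: leq_trans mn.
have d0 : 0 < d.
  by have [w _ /(le_lt_trans _)] := FV _ (nga_memF fg_nga 0); apply.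
(* Both families go into one space [Z], of dimension exactly [n + m] even if they are dependent
   together. *)
pose u (i : 'I_(n + m)) :=
  match fintype.split i with inl k => f k | inr j => v j end.
have [k|Z [Zdim Zu]] := @has_dim_superset _ _ _ (n + m)%N u.
  by exists (fun i : 'I_k => f i); apply: nga_lin_indep fg_nga k.
have Zf (k : 'I_n) : Z (f k) by have := Zu (unsplit (inl k)); rewrite /u unsplitK.
have Zv (j : 'I_m) : Z (v j) by have := Zu (unsplit (inr j)); rewrite /u unsplitK.
have [||T [Tl Tc]] := @banach_mazur_l2_lt _ _ (n + m)%N Z c _ Zdim.
- by rewrite addn_gt0 n0.
- by apply: le_lt_trans gc; apply: ereal_sup_ubound; exists Z.
have [z [_ ZE]] := Zdim.
have Z0 : Z 0 by rewrite ZE; apply: lin_span0.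
have Zlin a x y : Z x -> Z y -> Z (a *: x + y).
  by rewrite ZE => Zx Zy; apply: lin_spanD => //; apply: lin_spanZ.
have Zsum (I : finType) (a : I -> R) (w : I -> X) : (forall i, Z (w i)) ->
    Z (\sum_i a i *: w i) /\ T (\sum_i a i *: w i) = \sum_i a i *: T (w i).
  have T0 : T 0 = 0.
    by have := Tl (-1) 0 0 Z0 Z0; rewrite scaler0 addr0 scaleN1r addNr.
  move=> Zw; elim/big_rec2: _ => [//|i y x _ [Zx <-]].
  by split; [apply: Zlin | apply: Tl].
have c_gt0 : 0 < c.
  have := Tc _ (Zf (Ordinal n0)) => /andP[h1 h2].
  have f0 : 0 < `|f 0| by have := nga_tau_gt0 fg_nga 0.
  by have := lt_le_trans f0 (le_trans h1 h2); rewrite pmulr_lgt0.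
split=> //.
have /choice[w wP] : forall k : 'I_n, exists w, V w /\ `|f k - w| < d.
  by move=> k; have [w Vw fw] := FV _ (nga_memF fg_nga k); exists w.
have /choice[e eE] : forall k : 'I_n, exists e : 'I_m -> R, w k = \sum_j e j *: v j.
  by move=> k; have [+ _] := wP k; rewrite VE; apply: lin_span_rangeP.
have Zw k : Z (w k) by rewrite eE; have [] := Zsum _ (e k) v Zv.
pose A := \matrix_(k < n) T (f k); pose W := \matrix_(k < n) T (w k).
have rW : (\rank W <= m <= n)%N.
  rewrite (ltnW mn) andbT (_ : W = (\matrix_(k, j) e k j) *m \matrix_(j < m) T (v j)).
    exact: mulmx_max_rank.
  apply/row_matrixP => k; rewrite row_mul rowK eE (proj2 (Zsum _ _ _ Zv)).
  rewrite mulmx_sum_row; apply: eq_bigr => j _.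
  by rewrite rowK !mxE.
have gram_row p (B : 'M[R]_(p, n + m)) i : (B *m B^T) i i = l2norm (row i B) ^+ 2.
  by rewrite l2norm_sqr !gram_diagE; apply: eq_bigr => j _; rewrite mxE.
have l2ge0 (y : 'rV[R]_(n + m)) : 0 <= l2norm y by rewrite sqrtr_ge0.
have A_le k : (A *m A^T) k k <= c ^+ 2.
  rewrite gram_row rowK lerXn2r ?nnegrE ?(ltW c_gt0) //.
  have /andP[_ /le_trans] := Tc _ (Zf k); apply.
  by rewrite ler_piMr ?(ltW c_gt0) //; apply: F_ball; apply: nga_memF fg_nga k.
have AW_le k : ((A - W) *m (A - W)^T) k k <= (c * d) ^+ 2.
  have cd0 : 0 <= c * d by rewrite mulr_ge0 // ltW.
  rewrite gram_row lerXn2r ?nnegrE //.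
  have fwE : f k - w k = (-1) *: w k + f k by rewrite scaleN1r addrC.
  have -> : row k (A - W) = T (f k - w k).
    by rewrite linearB /= !rowK fwE Tl // scaleN1r addrC.
  have /Tc/andP[_ /le_trans] : Z (f k - w k) by rewrite fwE; apply: Zlin.
  by apply; rewrite ler_wpM2l ?ltW //; case: (wP k).
have [L [M [_ [Lt L1] _ D]]] := gram_schmidt A.
have detA : \det (A *m A^T) = (\prod_k l2norm (row k (L *m A))) ^+ 2.
  rewrite (det_gram_unitriangular (conj Lt L1) D) -prodrXl.
  by apply: eq_bigr => k _; rewrite gram_row.
(* Row [k] of [L A] is the image under [T] of [f k] plus a combination of earlier [f j], and [T]
   does not decrease norms on [Z]. *)
have row_ge k : s <= b k * l2norm (row k (L *m A)).
  apply: le_trans (s_tau k) _; have [] := Zsum _ (L k) _ Zf.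
  set y := \sum_j _ => Zy Ty.
  have -> : row k (L *m A) = T y.
    rewrite Ty row_mul mulmx_sum_row; apply: eq_bigr => j _.
    by rewrite rowK mxE.
  apply: le_trans (_ : b k * `|y| <= _); last first.
    by rewrite ler_wpM2l //; have /andP[] := Tc _ Zy.
  by apply: bP => // j kj; apply: (is_trig_mxP Lt).
have -> : s ^+ n = \prod_(k < n) s by rewrite prodr_const card_ord.
apply: le_trans (_ : \prod_k (b k * l2norm (row k (L *m A))) <= _).
  by apply: ler_prod => k _; rewrite s0 row_ge.
rewrite big_split /= ler_wpM2l ?prodr_ge0 //.
have rhs0 : 0 <= (Num.sqrt 2 * c) ^+ n * d ^+ (n - m).
  by rewrite mulr_ge0 ?exprn_ge0 ?mulr_ge0 ?sqrtr_ge0 // ltW.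
rewrite -(ler_pXn2r (ltn0Sn 1)) ?nnegrE ?prodr_ge0 // -detA.
have c2 : 0 < c ^+ 2 by rewrite exprn_gt0.
have cd2 : 0 < (c * d) ^+ 2 by rewrite exprn_gt0 // mulr_gt0.
(* With these [p] and [q] the bound is [2^n c^(2n) d^(2(n - m))], the square of the right-hand
   side. *)
apply: le_trans (det_gram_le rW c2 cd2 A_le AW_le) _.
rewrite le_eqVlt; apply/orP; left; apply/eqP.
rewrite -{1}(sqr_sqrtr (ler0n R 2)) -!exprM !exprMn.
have -> : (n = m + (n - m))%N by rewrite subnKC // ltnW.
rewrite !exprD addKn; ring.
Qed.

End Volume.

(** * From the volume inequality to the final estimate *)

Section Bound.
Context {R : realType} (X : normedModType R) (F : set X).
Context (f g : nat -> X) (phi : nat -> {linear X -> R^o}).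
Context (fg_nga : nga_realization F f g phi).
Context (F_ball : F `<=` [set x | `|x| <= 1]).

Lemma B_const_coef_bound n : exists (B : R) (b : 'I_n -> R),
  [/\ B_const g (n%:R / 2) = B%:E, 0 < B, nga_coef_bound f g phi b,
      forall k, 0 <= b k & \prod_k b k <= B ^+ n].
Proof.
have R1 : 1 <= R_const X := R_const_ge1 (nga_norm_g fg_nga 0).
have R0 : 0 < R_const X := lt_le_trans ltr01 R1.
have C0 := @basis_constant_ge0 _ _ g.
rewrite /B_const; case: leP => [_|CR].
  exists (R_const X `^ (n%:R / 2)), (fun k => R_const X ^+ k); split=> //.
  - exact: powR_gt0.
  - move=> k a ak aj; apply: le_trans (nga_residual_le_R fg_nga k _).
    by rewrite (nga_residual_unitriangular fg_nga ak aj) -(nga_residual_f fg_nga).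
  - by move=> k; rewrite exprn_ge0 // ltW.
  (* The exponents add up to [n (n - 1) / 2], at most [n] times [n / 2]: hence the index [n / 2] of
     [B_const]. *)
  rewrite prodrXr -!powR_mulrn ?powR_ge0 ?(ltW R0) // -powRrM; apply: ler_powR => //.
  rewrite -(big_mkord predT id) bin2_sum -mulrA [_ * n%:R]mulrC mulrA.
  rewrite ler_pdivlMr // -natrM -natrM ler_nat bin2 muln2.
  by rewrite -geq_half_double half_leq // leq_mul // leq_pred.
(* Here [C_g + 1] lies strictly below a real number. *)
have Cfin : basis_constant g \is a fin_num.
  rewrite ge0_fin_numE //; case: (basis_constant g) C0 CR => //= r _ _; exact: ltry.
move: C0; rewrite -(fineK Cfin) lee_fin; set C := fine _ => C0.
exists (C + 1), (fun=> C + 1); split=> //.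
- by rewrite ltr_wpDl.
- move=> k a ak aj; apply: (nga_tau_le_basis_constant fg_nga _ ak aj).
  by rewrite fineK.
- by move=> _; rewrite addr_ge0.
by rewrite prodr_const card_ord.
Qed.

(** [gamma_] and the width enter through strict upper bounds; this passes to the limit. *)
Lemma ler_mul_limr (M r s : R) : 0 < M -> (forall c, r < c -> s <= M * c) -> s <= M * r.
Proof.
move=> M0 h; apply/ler_addgt0Pr => e e0.
have := h (r + e / M); rewrite ltrDl divr_gt0 // mulrDr => /(_ isT).
by rewrite [M * (e / M)]mulrC divfK // gt_eqF.
Qed.

(** The [n]-th root of the volume inequality; [(n - m) / n] is the exponent of [d]. *)
Lemma nga_sigma_le n m (B c d : R) (b : 'I_n -> R) : (0 < m < n)%N ->
    0 < B -> nga_coef_bound f g phi b -> (forall k, 0 <= b k) ->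
    \prod_k b k <= B ^+ n ->
    (gamma_ X (n + m) < c%:E)%E -> (kolmogorov_width m F < d%:E)%E ->
  0 < c /\ fine (nga_sigma F f n) <= Num.sqrt 2 * B * c * d `^ (1 - m%:R / n%:R).
Proof.
move=> mn B0 bP b0 bB gc wd.
have [V [mV FV]] := kolmogorov_width_lt_ex wd.
have d0 : 0 < d.
  by rewrite -lte_fin; apply: lt_trans wd; apply: kolmogorov_width_gt0 fg_nga m.
set s := fine _.
have s0 : 0 <= s.
  by rewrite fine_ge0 //; apply: deviation_ge0; exists (f 0); apply: nga_memF fg_nga 0%N.
have s_tau (k : 'I_n) : s <= `|nga_residual g phi k (f k)|.
  rewrite -lee_fin fineK ?(nga_sigma_fin_num fg_nga) //.
  by apply: nga_sigma_le_tau => //; rewrite ltnW.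
have [c0 sn] := nga_volume fg_nga F_ball mn mV FV gc bP b0 s0 s_tau.
split=> //; case/andP: mn => m0 mn; have n0 : (0 < n)%N by apply: leq_trans mn.
have B1 : 0 <= Num.sqrt 2 * B * c by rewrite !mulr_ge0 ?sqrtr_ge0 // ltW.
rewrite -(ler_pXn2r n0) ?nnegrE //; last by rewrite (mulr_ge0 B1) ?powR_ge0.
have -> : (Num.sqrt 2 * B * c * d `^ (1 - m%:R / n%:R)) ^+ n
    = B ^+ n * ((Num.sqrt 2 * c) ^+ n * d ^+ (n - m)).
  have -> : d ^+ (n - m) = (d `^ (1 - m%:R / n%:R)) ^+ n.
    rewrite -!powR_mulrn ?powR_ge0 ?(ltW d0) // -powRrM; congr (_ `^ _).
    rewrite natrB 1?ltnW // mulrBl mul1r divfK // pnatr_eq0 -lt0n //.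
  by rewrite !exprMn; ring.
apply: le_trans sn _; apply: ler_wpM2r => //.
by rewrite mulr_ge0 ?exprn_ge0 ?mulr_ge0 ?sqrtr_ge0 // ltW.
Qed.

Lemma nga_sigma_le_width n m (B : R) (b : 'I_n -> R) : (0 < m < n)%N ->
    0 < B -> nga_coef_bound f g phi b -> (forall k, 0 <= b k) ->
    \prod_k b k <= B ^+ n ->
  (nga_sigma F f n <= (Num.sqrt 2 * B)%:E *
    (gamma_ X (n + m) * kolmogorov_width m F `^ (1 - m%:R / n%:R)))%E.
Proof.
move=> mn B0 bP b0 bB; rewrite -(fineK (nga_sigma_fin_num fg_nga n)).
have w0 := kolmogorov_width_gt0 fg_nga m; have w1 := kolmogorov_width_le1 fg_nga F_ball m.
have bound c d := @nga_sigma_le n m B c d b mn B0 bP b0 bB.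
have wfin : kolmogorov_width m F \is a fin_num.
  by rewrite ge0_fin_numE ?ltW // (le_lt_trans w1) // ltry.
move: w0 bound {w1}; rewrite -(fineK wfin) lte_fin; set w := fine _ => w0 bound.
rewrite poweR_EFin; set p := 1 - _ in bound *; set K := Num.sqrt 2 * B in bound *.
have K0 : 0 < K by rewrite mulr_gt0 // sqrtr_gt0.
have wp0 : 0 < w `^ p by apply: powR_gt0.
have p1 : p <= 1 by rewrite gerBl divr_ge0.
have {}bound c : (gamma_ X (n + m) < c%:E)%E -> 0 < c /\
    fine (nga_sigma F f n) <= K * w `^ p * c.
  move=> gc; have [|c0 _] := bound c (w + 1) gc; first by rewrite lte_fin ltrDl.
  split=> //; rewrite -[leRHS]mulr1; apply: ler_mul_limr => [|t t1].
    by rewrite !mulr_gt0.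
  (* The width bound is [w * t] with [t > 1]; as [p <= 1], the power of [t] is at most [t], so the
     limit [t = 1] is a linear one. *)
  have [|_] := bound c (w * t) gc; first by rewrite lte_fin ltr_pMr.
  move=> /le_trans; apply; rewrite powRM ?(ltW w0) ?(le_trans ler01 (ltW t1)) //.
  have tp : t `^ p <= t.
    by rewrite -[leRHS]powRr1 ?(le_trans ler01 (ltW t1)) // ler_powR // ltW.
  rewrite mulrA (_ : K * w `^ p * c * t = K * c * w `^ p * t); last by ring.
  by apply: ler_wpM2l tp; rewrite ltW // !mulr_gt0.
(* The value [+oo] makes the right-hand side infinite because the power of [w] is positive; [-oo]
   would give [0 < 0]. *)
case: (gamma_ X (n + m)) bound => [r| |] bound.
- rewrite -!EFinM lee_fin mulrCA mulrC; apply: ler_mul_limr => [|c rc].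
    exact: mulr_gt0.
  by have [|_] := bound c; rewrite ?lte_fin.
- by rewrite gt0_mulye ?lte_fin // gt0_muley ?lte_fin // leey.
- by have [] := bound 0 (ltNyr _); rewrite ltxx.
Qed.

End Bound.

Theorem theorem3p7 (R : realType) (X : completeNormedModType R) (F : set X)
    (F_compact : compact F)
    (F_ball : F `<=` [set x | `|x| <= 1])
    (F_infdim : infinite_dim (lin_span F))
    (f g : nat -> X) (phi : nat -> {linear X -> R^o})
    (fg_nga : nga_realization F f g phi)
    (n : nat) (n_ge2 : (2 <= n)%N) :
  (nga_sigma F f n <=
    (Num.sqrt 2)%:E * B_const g (n%:R / 2) *
    \big[Order.min/+oo]_(1 <= m < n)
      (gamma_ X (n + m) *
       kolmogorov_width m F `^ (1 - m%:R / n%:R)))%E.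
Proof.
have [B [b [-> B0 bP b0 bB]]] := B_const_coef_bound fg_nga n.
(* The neutral element [+oo] of the minimum yields an infinite right-hand side, as the constant
   factor is positive. *)
rewrite -EFinM big_nat; elim/big_ind: _ => [|x y|m mn].
- by rewrite gt0_muley ?leey // lte_fin mulr_gt0 // sqrtr_gt0.
- by move=> xP yP; case: (leP x y).
- exact: (nga_sigma_le_width fg_nga F_ball mn B0 bP b0 bB).
Qed.
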